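(* Every van Benthem-formula $\phi$ has a local first-order frame correspondent: there is a formula $\alpha(x)$ of $L_0$ with $x$ as its only free variable such that for every Kripke frame $\mathcal{F}=(W,R)$ and every $w\in W$, $\mathcal{F},w\Vdash\phi$ iff $\mathcal{F}\models\alpha[x:=w]$.
   Context: Modal formulas are built by $\varphi::= p \mid \bot \mid \neg\varphi \mid \varphi\vee\varphi \mid \Diamond\varphi$ over a set $\mathsf{Prop}$ of variables. A Kripke frame is $\mathcal{F}=(W,R)$ with $W\neq\emptyset$, $R\subseteq W\times W$; a valuation is $V:\mathsf{Prop}\to\mathcal{P}(W)$; truth is standard ($w\Vdash\Diamond\varphi$ iff some $R$-successor of $w$ satisfies $\varphi$), and $\mathcal{F},w\Vdash\phi$ means $\phi$ is true at $w$ under every valuation. $L_0$ is the first-order language with $=$ and a binary relation symbol $R$; $L_1$ extends $L_0$ with a unary predicate symbol $P$ for each $p\in\mathsf{Prop}$. The standard translation is $ST_x(p)=Px$, $ST_x(\bot)= x\neq x$, $ST_x(\neg\varphi)=\neg ST_x(\varphi)$, $ST_x(\varphi\vee\psi)=ST_x(\varphi)\vee ST_x(\psi)$, $ST_x(\Diamond\varphi)=\exists y(Rxy\wedge ST_y(\varphi))$ with $y$ fresh. A formula $\phi$ with variables $p_1,\dots,p_n$ is a van Benthem-formula if $\forall P_1\cdots\forall P_n\, ST_x(\phi)$ is equivalent to the same formula in which the second-order quantifiers range not over all subsets of the domain but only over those subsets definable by $L_0$-formulas (i.e.\ for every frame and every $w$, $ST_x(\phi)$ holds at $w$ for all interpretations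 of the $P_i$ iff it holds at $w$ for all interpretations of the $P_i$ by $L_0$-definable subsets). *)

(* Defs.v *)
From mathcomp Require Import all_boot.
From mathcomp Require Import classical_sets.

Set Implicit Arguments.
Unset Strict Implicit.
Unset Printing Implicit Defensive.

Inductive modal (PV : Type) : Type :=
| MVar of PV
| MBot
| MNeg of modal PV
| MOr of modal PV & modal PV
| MDia of modal PV.

Arguments MBot {PV}.

Fixpoint occurs (PV : Type) (p : PV) (phi : modal PV) : Prop :=
  match phi with
  | MVar q => p = q
  | MBot => False
  | MNeg psi => occurs p psi
  | MOr psi chi => occurs p psi \/ occurs p chi
  | MDia psi => occurs p psi
  end.

Record frame : Type := Frame {
  world :> Type;
  acc : world -> world -> Prop;
  world_inhabited : inhabited world }.

Definition valuation (PV : Type) (F : frame) : Type := PV -> set F.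

Fixpoint msat (PV : Type) (F : frame) (V : valuation PV F) (w : F)
    (phi : modal PV) : Prop :=
  match phi with
  | MVar p => V p w
  | MBot => False
  | MNeg psi => ~ msat V w psi
  | MOr psi chi => msat V w psi \/ msat V w chi
  | MDia psi => exists v : F, acc w v /\ msat V v psi
  end.

Definition valid_at (PV : Type) (F : frame) (w : F) (phi : modal PV) : Prop :=
  forall V : valuation PV F, msat V w phi.

(* First-order formulas over equality, the binary symbol R and the unary      *)
(* predicate symbols in Q, with individual variables named by nat. The        *)
(* universal quantifier is not primitive: it is ~ exists ~.                   *)
Inductive fo (Q : Type) : Type :=
| FEq of nat & nat
| FRel of nat & nat
| FPred of Q & nat
| FNot of fo Q
| FOr of fo Q & fo Q
| FAnd of fo Q & fo Q
| FEx of nat & fo Q.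

Arguments FEq {Q} _ _.
Arguments FRel {Q} _ _.

Notation L0 := (fo void).
Notation L1 PV := (fo PV).

Fixpoint free_in (Q : Type) (x : nat) (A : fo Q) : Prop :=
  match A with
  | FEq y z => x = y \/ x = z
  | FRel y z => x = y \/ x = z
  | FPred _ y => x = y
  | FNot B => free_in x B
  | FOr B C => free_in x B \/ free_in x C
  | FAnd B C => free_in x B \/ free_in x C
  | FEx y B => x <> y /\ free_in x B
  end.

Definition upd (T : Type) (g : nat -> T) (x : nat) (w : T) : nat -> T :=
  fun y => if y == x then w else g y.

Fixpoint fsat (Q : Type) (F : frame) (V : Q -> set F) (g : nat -> F)
    (A : fo Q) : Prop :=
  match A with
  | FEq y z => g y = g z
  | FRel y z => acc (g y) (g z)
  | FPred P y => V P (g y)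
  | FNot B => ~ fsat V g B
  | FOr B C => fsat V g B \/ fsat V g C
  | FAnd B C => fsat V g B /\ fsat V g C
  | FEx y B => exists v : F, fsat V (upd g y v) B
  end.

(* Satisfaction of A[x := w]; meant for A with no free variable other than x, *)
(* so that the remaining values of g are irrelevant.                          *)
Definition sat_at (Q : Type) (F : frame) (V : Q -> set F) (x : nat) (w : F)
    (A : fo Q) : Prop :=
  forall g : nat -> F, g x = w -> fsat V g A.

Definition no_pred (F : frame) : void -> set F := fun P => of_void (set F) P.

(* x.+1 is fresh because the only free variable of ST x phi is x. *)
Fixpoint ST (PV : Type) (x : nat) (phi : modal PV) : L1 PV :=
  match phi with
  | MVar p => FPred p x
  | MBot => FNot (FEq x x)
  | MNeg psi => FNot (ST x psi)
  | MOr psi chi => FOr (ST x psi) (ST x chi)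
  | MDia psi => FEx x.+1 (FAnd (FRel x x.+1) (ST x.+1 psi))
  end.

(* Definability with parameters: the assignment g interprets the free         *)
(* variables of A other than z. Parameters are what make, e.g., the minimal   *)
(* valuations R[w] of Sahlqvist formulas definable; forbidding them would     *)
(* only make van_benthem below a stronger condition.                          *)
Definition definable (F : frame) (X : set F) : Prop :=
  exists (A : L0) (z : nat) (g : nat -> F),
    forall v : F, X v <-> fsat (@no_pred F) (upd g z v) A.

Definition van_benthem (PV : Type) (x : nat) (phi : modal PV) : Prop :=
  forall (F : frame) (w : F),
    (forall V : PV -> set F, sat_at V x w (ST x phi)) <->
    (forall V : PV -> set F, (forall p, occurs p phi -> definable (V p)) ->
       sat_at V x w (ST x phi)).

(* Main.v *)
Require Import Defs.
From mathcomp Require Import all_boot.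
From mathcomp Require Import boolp classical_sets filter.

(** The first-order consequences of [phi] at a point are closed under
    conjunction. If none of them implied [phi], then an ultraproduct of
    counterexamples, one for each consequence, would be a pointed frame
    satisfying all of them and refuting [phi]. Since [phi] is a van
    Benthem-formula, it would already be refuted there by a valuation defined
    by [L0]-formulas with parameters. Substituting these formulas for the
    variables in the standard translation of [phi], and quantifying universally
    over the parameters, gives a first-order consequence of [phi] that fails
    there, a contradiction. *)

Set Implicit Arguments.
Unset Strict Implicit.
Unset Printing Implicit Defensive.

Local Open Scope classical_set_scope.

(** * Updates of assignments *)

Lemma upd_eq (T : Type) (g : nat -> T) (x : nat) (w : T) : upd g x w x = w.
Proof. by rewrite /upd eqxx. Qed.

Lemma upd_neq (T : Type) (g : nat -> T) (x y : nat) (w : T) :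
  y <> x -> upd g x w y = g y.
Proof. by rewrite /upd; case: eqP. Qed.

Lemma upd_id (T : Type) (g : nat -> T) (x : nat) : upd g x (g x) = g.
Proof. by apply: funext => y; rewrite /upd; case: eqP => [->|]. Qed.

Lemma upd_comp (S T : Type) (f : S -> T) (g : nat -> S) (x : nat) (w : S) :
  upd (f \o g) x (f w) = f \o upd g x w.
Proof. by apply: funext => y; rewrite /upd /=; case: eqP. Qed.

Lemma void_valuation (F : frame) (V : void -> set F) : V = @no_pred F.
Proof. by apply: funext => -[]. Qed.

(** * Ultraproducts of frames and Łoś's theorem *)

Section Ultraproduct.

Variables (I : Type) (U : set_system I) (F : I -> frame).
Hypothesis UU : UltraFilter U.

Let thread : Type := forall i, F i.

Let germ (f : thread) : set thread := [set h | U [set i | f i = h i]].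

Lemma germP (f h : thread) : germ f = germ h <-> U [set i | f i = h i].
Proof.
split=> [fh|Ufh].
  have : germ h h by apply: filterS filterT.
  by rewrite -fh.
apply/seteqP; split=> k Uk; apply: filterS (filterI Ufh Uk) => i /= [-> ->] //.
Qed.

(** A world is a whole equivalence class of threads modulo agreement on a set of [U], so that [FEq]
    is interpreted by true equality. *)
Definition ultra_world : Type := {X : set thread | exists f, X = germ f}.

Definition ultra_class (f : thread) : ultra_world :=
  exist _ (germ f) (ex_intro _ f erefl).

Lemma ultra_class_eq (f h : thread) :
  ultra_class f = ultra_class h <-> U [set i | f i = h i].
Proof.
rewrite -germP; split=> [[]//|fh]; exact: eq_exist.
Qed.

Lemma ultra_class_surj (c : ultra_world) : exists f, c = ultra_class f.
Proof. by case: c => X [f Xf]; exists f; apply: eq_exist. Qed.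

Lemma ultra_thread : exists f : thread, True.
Proof.
have f i : {w : F i | True}.
  by apply: cid; case: (world_inhabited (F i)) => w; exists w.
by exists (fun i => sval (f i)).
Qed.

Definition ultra_acc (c d : ultra_world) : Prop :=
  exists f h, [/\ c = ultra_class f, d = ultra_class h
                & U [set i | acc (f i) (h i)]].

Lemma ultra_inhabited : inhabited ultra_world.
Proof. by case: ultra_thread => f _; apply: (inhabits (ultra_class f)). Qed.

Definition ultraproduct : frame := Frame ultra_acc ultra_inhabited.

Definition ultra_valuation (Q : Type) (V : forall i, Q -> set (F i)) :
  Q -> set ultraproduct :=
  fun P => [set c | exists f, c = ultra_class f /\ U [set i | V i P (f i)]].

Lemma ultra_setC (A : set I) : U (~` A) <-> ~ U A.
Proof.
split=> [UnA UA|nUA]; last by case: (in_ultra_setVsetC A UU).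
by apply: (filter_not_empty U); rewrite -(setICr A); apply: filterI.
Qed.

(** Łoś's theorem, by induction on [A]. Maximality of [U] gives negation and disjunction; choosing a
    witness at each index gives the quantifier. *)
Lemma los (Q : Type) (V : forall i, Q -> set (F i)) (A : fo Q)
    (h : nat -> thread) :
  fsat (ultra_valuation V) (ultra_class \o h) A <->
  U [set i | fsat (V i) (h ^~ i) A].
Proof.
elim: A h => [y z|y z|P y|B IH|B IHB C IHC|B IHB C IHC|y B IH] h /=.
- exact: ultra_class_eq.
- split=> [[f [k [/ultra_class_eq hf /ultra_class_eq hk Ufk]]]|Uyz].
    by apply: filterS (filterI hf (filterI hk Ufk)) => i /= [-> [->]].
  by exists (h y), (h z).
- split=> [[f [/ultra_class_eq hf Uf]]|Uy]; last by exists (h y).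
  by apply: filterS (filterI hf Uf) => i /= [->].
- by rewrite IH -ultra_setC.
- rewrite IHB IHC; split=> [[UB|UC]|UBC].
  + by apply: filterS UB => i; left.
  + by apply: filterS UC => i; right.
  apply: contrapT => /not_orP[/ultra_setC nB /ultra_setC nC].
  by case: (filter_ex (filterI UBC (filterI nB nC))) => i [[?|?] []].
- rewrite IHB IHC; split=> [[UB UC]|UBC]; first exact: filterI.
  by split; apply: filterS UBC => i [].
- have updi f i : upd (h ^~ i) y (f i) = (upd h y f) ^~ i.
    by apply: funext => n; rewrite /upd; case: eqP.
  split=> [[c]|].
    have [f ->] := ultra_class_surj c.
    rewrite upd_comp IH; apply: filterS => i /= Bi.
    by exists (f i); rewrite updi.
  move=> UB.
  (* Each index gets a witness if it has one; [h y i] is only a default value. *)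
  have ff i : {v : F i | (exists v, fsat (V i) (upd (h ^~ i) y v) B) ->
                         fsat (V i) (upd (h ^~ i) y v) B}.
    apply: cid; case: (EM (exists v, fsat (V i) (upd (h ^~ i) y v) B)).
      by move=> [v Bv]; exists v.
    by move=> nB; exists (h y i).
  pose f i := sval (ff i).
  exists (ultra_class f); rewrite upd_comp IH.
  by apply: filterS UB => i /(svalP (ff i)); rewrite -/(f i) updi.
Qed.

End Ultraproduct.

Arguments ultra_class {I} U {F} f.

(** * Correctness of the standard translation *)

Lemma fsat_ST (PV : Type) (F : frame) (V : valuation PV F) (phi : modal PV)
    (x : nat) (g : nat -> F) :
  fsat V g (ST x phi) <-> msat V (g x) phi.
Proof.
elim: phi x g => [p||psi IH|psi IHl chi IHr|psi IH] x g //=.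
- by rewrite IH.
- by rewrite IHl IHr.
- split=> -[v []]; rewrite ?IH ?upd_eq ?upd_neq; try exact: n_Sn.
    by move=> xv ?; exists v.
  by move=> xv ?; exists v; rewrite IH ?upd_eq ?upd_neq; try exact: n_Sn.
Qed.

Lemma sat_at_ST (PV : Type) (F : frame) (V : valuation PV F) (phi : modal PV)
    (x : nat) (w : F) :
  sat_at V x w (ST x phi) <-> msat V w phi.
Proof.
split=> [/(_ (fun=> w) erefl)/fsat_ST //|Vw g gw].
by rewrite fsat_ST gw.
Qed.

Lemma van_benthemP (PV : Type) (x : nat) (phi : modal PV) :
  van_benthem x phi -> forall (F : frame) (w : F),
  (forall V : PV -> set F,
     (forall p, occurs p phi -> definable (V p)) -> msat V w phi) ->
  valid_at w phi.
Proof.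
move=> vb F w defw V; apply/(sat_at_ST V phi x w); move: V; apply/vb => V defV.
exact/sat_at_ST/defw.
Qed.

(** * Universal closure *)

Definition fall (Q : Type) (y : nat) (A : fo Q) : fo Q := FNot (FEx y (FNot A)).

Lemma sat_at_fall (Q : Type) (F : frame) (V : Q -> set F) (x y : nat) (w : F)
    (A : fo Q) :
  y <> x -> sat_at V x w (fall y A) <-> sat_at V x w A.
Proof.
move=> yx; split=> Aw g gx /=.
  apply: contrapT => nA; apply: (Aw g gx).
  by exists (g y); rewrite upd_id.
move=> [v]; apply; apply: Aw; rewrite upd_neq //; exact: nesym.
Qed.

Lemma free_in_bounded (Q : Type) (A : fo Q) :
  exists n, forall y, free_in y A -> y < n.
Proof.
elim: A => [y z|y z|P y|B IH|B [m IHB] C [n IHC]|B [m IHB] C [n IHC]|y B [n IH]]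
  //=; try by exists (maxn y z).+1 => u [] ->;
    rewrite ltnS (leq_maxl, leq_maxr).
- by exists y.+1 => u ->.
- by exists (maxn m n) => u [/IHB|/IHC] lt; rewrite leq_max lt ?orbT.
- by exists (maxn m n) => u [/IHB|/IHC] lt; rewrite leq_max lt ?orbT.
- by exists n => u [_ /IH].
Qed.

(** [sat_at] already ranges over all values of the variables other than [x], so binding them
    universally does not change it. *)
Lemma universal_closure (x : nat) (A : L0) :
  exists alpha : L0, (forall y, free_in y alpha <-> y = x) /\
    forall (F : frame) (w : F),
      sat_at (@no_pred F) x w alpha <-> sat_at (@no_pred F) x w A.
Proof.
have [n ltn] := free_in_bounded A.
pose s := [seq y <- iota 0 n | y != x].
(* The conjunct [FEq x x] makes [x] free even when it is not free in [A]. *)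
exists (FAnd (FEq x x) (foldr (@fall _) A s)); split=> [y|F w] /=.
  split=> [|->]; last by left; left.
  case=> [[]//|fy]; apply: contrapT => /eqP yx.
  have [ys fA] : y \notin s /\ free_in y A.
    elim: s fy => //= z s IH [yz /IH[ys fA]]; split=> //.
    by rewrite inE negb_or ys andbT; apply/eqP.
  by move: ys; rewrite mem_filter yx mem_iota add0n ltn.
have -> : sat_at (@no_pred F) x w A <->
          sat_at (@no_pred F) x w (foldr (@fall _) A s).
  have : x \notin s by rewrite mem_filter eqxx.
  elim: s => //= y s IH; rewrite inE negb_or => /andP[xy /IH ->].
  by rewrite sat_at_fall //; apply/eqP; rewrite eq_sym.
split=> Aw g /Aw //=.
by case.
Qed.

(** * Substitution of first-order formulas for propositional variables *)

Fixpoint rename (Q : Type) (e : nat -> nat) (A : fo Q) : fo Q :=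
  match A with
  | FEq y z => FEq (e y) (e z)
  | FRel y z => FRel (e y) (e z)
  | FPred P y => FPred P (e y)
  | FNot B => FNot (rename e B)
  | FOr B C => FOr (rename e B) (rename e C)
  | FAnd B C => FAnd (rename e B) (rename e C)
  | FEx y B => FEx (e y) (rename e B)
  end.

Lemma upd_inj (T : Type) (e : nat -> nat) (g : nat -> T) (x : nat) (w : T) :
  injective e -> upd g (e x) w \o e = upd (g \o e) x w.
Proof. by move=> einj; apply: funext => y; rewrite /upd /= (inj_eq einj). Qed.

Lemma fsat_rename (Q : Type) (F : frame) (V : Q -> set F) (e : nat -> nat)
    (A : fo Q) (g : nat -> F) :
  injective e -> fsat V g (rename e A) <-> fsat V (g \o e) A.
Proof.
move=> einj; elim: A g => //= [B IH|B IHB C IHC|B IHB C IHC|y B IH] g.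
- by rewrite IH.
- by rewrite IHB IHC.
- by rewrite IHB IHC.
- by split=> -[v Bv]; exists v; move: Bv; rewrite IH upd_inj.
Qed.

Section Instance.

Variables (PV : Type) (A : PV -> L0) (z : PV -> nat) (e : PV -> nat -> nat).

(* The substitution of [A p], renamed by [e p], for the variable [p] in [ST].
   Capture is avoided by equating the renamed variable [z p] of [A p] with the
   current one, and by stepping by 2, so that the variables of the parity of [x]
   stand for worlds and the others are left for the [A p] and their
   parameters. *)
Fixpoint ST_inst (x : nat) (phi : modal PV) : L0 :=
  match phi with
  | MVar p =>
      FEx (e p (z p)) (FAnd (FEq (e p (z p)) x) (rename (e p) (A p)))
  | MBot => FNot (FEq x x)
  | MNeg psi => FNot (ST_inst x psi)
  | MOr psi chi => FOr (ST_inst x psi) (ST_inst x chi)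
  | MDia psi => FEx x.+2 (FAnd (FRel x x.+2) (ST_inst x.+2 psi))
  end.

Definition inst_valuation (F : frame) (g : nat -> F) : valuation PV F :=
  fun p => [set v | fsat (@no_pred F) (upd (g \o e p) (z p) v) (A p)].

Hypothesis e_inj : forall p, injective (e p).

(** The hypothesis keeps the names [e p i] away from [x], [x.+2], [x.+4] and so on. Hence moving to
    a successor world never alters a parameter, and [inst_valuation g] stays the same throughout the
    induction. *)
Lemma fsat_ST_inst (x : nat) (F : frame) (g : nat -> F) (phi : modal PV) :
  (forall p i j, e p i <> x + j.*2) ->
  fsat (@no_pred F) g (ST_inst x phi) <-> msat (inst_valuation g) (g x) phi.
Proof.
elim: phi x g => [p||psi IH|psi IHl chi IHr|psi IH] x g ex /=.
- have xe : x <> e p (z p)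
    by move=> /esym; rewrite -[x]addn0; exact: (ex _ _ 0).
  split=> [[v]|Vx].
    rewrite upd_eq (upd_neq _ _ xe) fsat_rename // upd_inj //.
    by move=> [->].
  by exists (g x); rewrite upd_eq (upd_neq _ _ xe) fsat_rename // upd_inj.
- by split=> // /(_ erefl).
- by rewrite IH.
- by rewrite IHl // IHr.
- have ex2 p i j : e p i <> x.+2 + j.*2.
    by move=> epi; apply: (ex p i j.+1); rewrite epi doubleS !addnS !addSn.
  have xx : x <> x.+2
    by move=> /eqP; rewrite -addn2 -[X in X == _]addn0 eqn_add2l.
  have Vg v : inst_valuation (upd g x.+2 v) = inst_valuation g.
    apply: funext => p; rewrite /inst_valuation.
    have -> // : upd g x.+2 v \o e p = g \o e p.
    apply: funext => i /=; rewrite upd_neq // => epi.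
    by apply: (ex2 p i 0); rewrite addn0.
  have step v : fsat (@no_pred F) (upd g x.+2 v) (ST_inst x.+2 psi) <->
                msat (inst_valuation g) v psi by rewrite IH // Vg upd_eq.
  by split=> -[v [xv Pv]]; exists v; move: xv Pv;
    rewrite step upd_eq (upd_neq _ _ xx).
Qed.

End Instance.

(** * The variables occurring in a formula *)

Lemma msat_occurs (PV : Type) (F : frame) (V V' : valuation PV F)
    (phi : modal PV) (w : F) :
  (forall p, occurs p phi -> V p = V' p) -> msat V w phi <-> msat V' w phi.
Proof.
elim: phi w => [p||psi IH|psi IHl chi IHr|psi IH] w VV' //=.
- by rewrite VV'.
- by rewrite IH.
- by rewrite IHl ?IHr // => p op; apply: VV'; [right|left].
- by split=> -[v [wv ?]]; exists v; split=> //; apply/(IH v VV').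
Qed.

(** [PV] may be uncountable, but the variables of [phi] form a finite list, and the position in it
    numbers them. This lets their parameters receive disjoint sets of names. *)
Lemma occurs_index (PV : Type) (phi : modal PV) :
  exists k : PV -> nat,
    forall p q, occurs p phi -> occurs q phi -> k p = k q -> p = q.
Proof.
pose fix vars (psi : modal PV) : seq {classic PV} :=
  match psi with
  | MVar p => [:: (p : {classic PV})]
  | MBot => [::]
  | MNeg psi => vars psi
  | MOr psi chi => vars psi ++ vars chi
  | MDia psi => vars psi
  end.
have vars_occurs psi (p : {classic PV}) : occurs p psi -> p \in vars psi.
  elim: psi => [q||psi IH|psi IHl chi IHr|psi IH] //=.
    by move=> ->; rewrite mem_seq1.
  by rewrite mem_cat => -[/IHl ->|/IHr ->] //; rewrite orbT.
exists (fun p => index (p : {classic PV}) (vars phi)) => p q op oq kpq.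
have := congr1 (nth (p : {classic PV}) (vars phi)) kpq.
by rewrite !nth_index //; exact: vars_occurs.
Qed.

(** * First-order consequences and compactness by ultraproducts *)

Section Correspondence.

Variables (PV : Type) (x : nat) (phi : modal PV).

Definition consequence (A : L0) : Prop :=
  forall (F : frame) (w : F), valid_at w phi -> sat_at (@no_pred F) x w A.

(** The instance of [phi] at the defining formulas is a consequence, because every assignment makes
    it express the truth of [phi] under some valuation. It is then read at the assignment that
    carries the actual parameters. *)
Lemma consequences_definable_valid (F : frame) (w : F) (V : PV -> set F) :
  (forall A, consequence A -> sat_at (@no_pred F) x w A) ->
  (forall p, occurs p phi -> definable (V p)) -> msat V w phi.
Proof.
move=> Fw defV.
have /choice[D DP] : forall p, exists D : L0 * nat * (nat -> F),
    occurs p phi -> forall v, V p v <->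
      fsat (@no_pred F) (upd D.2 D.1.2 v) D.1.1.
  move=> p; case: (EM (occurs p phi)) => [/defV[A [z [g Vp]]]|np].
    by exists (A, z, g).
  (* An arbitrary value for variables outside [phi]. *)
  by exists (FEq 0 0, 0, fun=> w).
have [k kinj] := occurs_index phi.
(* Odd offsets from [x] avoid the names of worlds; coding the pair [(k p, i)] separates the
   parameters of distinct variables of [phi]. *)
pose e p (i : nat) := x + (pickle (k p, i)).*2.+1.
have e_eq p q i j : e p i = e q j -> k p = k q /\ i = j.
  move=> /eqP; rewrite eqn_add2l eqSS => /eqP/double_inj.
  by move=> /(pcan_inj pickleK) [].
have ex p i j : e p i <> x + j.*2.
  move=> /eqP; rewrite eqn_add2l => /eqP/(congr1 odd).
  by rewrite /= !odd_double.
have e_inj p : injective (e p) by move=> i j /e_eq[].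
(* Since these names do not clash, one assignment can hold [w] at [x] and all parameters of all
   defining formulas. *)
have /choice[g gP] : forall y, exists u, (y = x -> u = w) /\
    forall p i, occurs p phi -> y = e p i -> u = (D p).2 i.
  move=> y; case: (EM (exists p i, occurs p phi /\ y = e p i)).
    move=> [p [i [op ->]]]; exists ((D p).2 i); split=> [epx|q j oq].
      by case: (ex p i 0); rewrite epx addn0.
    by move=> /e_eq[/(kinj _ _ op oq) -> ->].
  move=> ny; exists w; split=> // p i op yp.
  by case: ny; exists p, i.
pose A p := (D p).1.1; pose z p := (D p).1.2.
have gx : g x = w by case: (gP x) => ->.
have : consequence (ST_inst A z e x phi).
  move=> G u uphi h hx.
  by apply/fsat_ST_inst => //; rewrite hx; exact: uphi.
move=> /Fw/(_ g gx); rewrite fsat_ST_inst // gx.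
apply: (msat_occurs w _).1 => p op.
have gD : g \o e p = (D p).2 by apply: funext => i /=; apply: (gP _).2.
by apply: funext => v; apply: propext; rewrite DP // /inst_valuation gD.
Qed.

Record countermodel (A : L0) : Type := Countermodel {
  cm_frame : frame;
  cm_point : cm_frame;
  cm_valuation : valuation PV cm_frame;
  cm_sat : sat_at (@no_pred cm_frame) x cm_point A;
  cm_refutes : ~ msat cm_valuation cm_point phi }.

Lemma consequences_refuted :
  (forall A, consequence A -> inhabited (countermodel A)) ->
  exists (F : frame) (w : F), ~ valid_at w phi /\
    forall A, consequence A -> sat_at (@no_pred F) x w A.
Proof.
move=> cms.
pose I := {A : L0 | consequence A}.
have MM (i : I) : {M : countermodel (sval i) | True}.
  by apply: cid; case: (cms _ (svalP i)) => M; exists M.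
pose M i := sval (MM i).
(* The consequences at least as strong as [i]. Closure under conjunction makes these sets a filter
   base, to be extended to an ultrafilter. *)
pose above (i : I) : set I := [set j |
  forall (F : frame) (w : F), sat_at (@no_pred F) x w (sval j) ->
                              sat_at (@no_pred F) x w (sval i)].
have top : consequence (FEq 0 0) by move=> F w _ g.
have base_proper : ProperFilter (filter_from [set: I] above).
  apply: filter_from_proper; last by move=> i _; exists i.
  apply: filter_from_filter; first by exists (exist _ _ top).
  move=> [A cA] [B cB] _ _.
  have cAB : consequence (FAnd A B).
    by move=> F w vw g gx; split; [apply: cA gx|apply: cB gx].
  exists (exist _ _ cAB) => // -[C cC] /= CAB.
  by split=> F w /CAB ABw g /ABw [].
have [U [UU sU]] := ultraFilterLemma base_proper.
pose F i := cm_frame (M i).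
pose pt i : F i := cm_point (M i).
pose V i : PV -> set (F i) := @cm_valuation _ (M i).
exists (ultraproduct U F), (ultra_class U pt); split.
  (* If [phi] held under the ultraproduct of the refuting valuations, it would hold in some
     countermodel. *)
  move=> /(_ (ultra_valuation V))/(sat_at_ST _ _ x).
  move=> /(_ (ultra_class U \o fun=> pt) erefl)/los.
  by move=> /filter_ex[i /fsat_ST]; exact: cm_refutes.
move=> A cA g gx.
have /choice[h hP] := fun y => ultra_class_surj (g y).
have -> : g = ultra_class U \o h by exact: funext.
rewrite -(void_valuation (ultra_valuation (fun i => @no_pred (F i)))).
apply/los.
have Ux : U [set i | h x i = pt i] by apply/ultra_class_eq; rewrite -hP.
(* The countermodel of any [j] in this set satisfies [sval j], hence also [A]. *)
have UA : U (above (exist _ A cA)) by apply: sU; exists (exist _ A cA).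
apply: filterS (filterI Ux UA) => i [hx iA].
by apply: iA hx; exact: cm_sat.
Qed.

End Correspondence.

Theorem theorem3p2 (PV : Type) (x : nat) (phi : modal PV) :
  van_benthem x phi ->
  exists alpha : L0,
    (forall y : nat, free_in y alpha <-> y = x) /\
    (forall (F : frame) (w : F),
       valid_at w phi <-> sat_at (@no_pred F) x w alpha).
Proof.
move=> vb.
have [A [cA Aphi]] : exists A, consequence x phi A /\
    forall (F : frame) (w : F), sat_at (@no_pred F) x w A -> valid_at w phi.
  apply: contrapT => nA.
  case: (@consequences_refuted _ x phi) => [A cA|F [w [nw Fw]]].
    (* A consequence without a countermodel would imply [phi] at every point. *)
    apply: contrapT => nM; apply: nA; exists A; split=> // F w Aw V.
    by apply: contrapT => nV; apply: nM; constructor; exact: Countermodel Aw nV.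
  apply: nw; apply: (van_benthemP vb) => V.
  exact: (consequences_definable_valid Fw).
have [alpha [fv alphaA]] := universal_closure x A.
by exists alpha; split=> // F w; rewrite alphaA; split=> [/cA|/Aphi].
Qed.
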